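(* Let $\mathcal{B}=(b_{i_1\cdots i_m})$ be a symmetric double $B$-tensor of order $m$ and dimension $n$. Then at least one of the following holds: $\mathcal{B}$ is itself a DSDD symmetric $Z$-tensor, or $$\mathcal{B}=\mathcal{M}+\sum_{k=1}^{s}h_k\,\varepsilon^{\hat{J}_k},$$ where $\mathcal{M}$ is a DSDD symmetric $Z$-tensor, $s$ is a positive integer, and $h_k>0$ and $\hat{J}_k\subseteq N$ for $k=1,2,\ldots,s$. Furthermore, if $m$ is even, then $\mathcal{B}$ is positive definite, and consequently $\mathcal{B}$ is a $P$-tensor.
   Context: Let $m\ge 2$, $n\ge 2$, $N=\{1,\ldots,n\}$. A real tensor $\mathcal{A}=(a_{i_1\cdots i_m})$ of order $m$ and dimension $n$ consists of $n^m$ real entries indexed by $i_1,\ldots,i_m\in N$. It is symmetric if its entries are invariant under all permutations of the $m$ indices. $\delta_{i_1\cdots i_m}=1$ if $i_1=\cdots=i_m$ and $0$ otherwise; entries with $\delta_{i_1\cdots i_m}=0$ are called off-diagonal. For $i\in N$ put $\beta_i(\mathcal{A})=\max\{0,\ a_{ij_2\cdots j_m}: j_2,\ldots,j_m\in N,\ \delta_{ij_2\cdots j_m}=0\}$ and $\Delta_i(\mathcal{A})=\sum_{i_2,\ldots,i_m\in N,\ \delta_{ii_2\cdots i_m}=0}(\beta_i(\mathcal{A})-a_{ii_2\cdots i_m})$. A real tensor $\mathcal{B}=(b_{i_1\cdots i_m})$ with $b_{i\cdots i}>\beta_i(\mathcal{B})$ for all $i\in N$ is a double $B$-tensor if (I)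 $b_{i\cdots i}-\beta_i(\mathcal{B})\ge\Delta_i(\mathcal{B})$ for every $i\in N$, and (II) $(b_{i\cdots i}-\beta_i(\mathcal{B}))(b_{j\cdots j}-\beta_j(\mathcal{B}))>\Delta_i(\mathcal{B})\Delta_j(\mathcal{B})$ for all $i,j\in N$, $i\ne j$. A $Z$-tensor is a real tensor all of whose off-diagonal entries are non-positive. Let $r_i(\mathcal{A})=\sum_{i_2,\ldots,i_m\in N,\ \delta_{ii_2\cdots i_m}=0}|a_{ii_2\cdots i_m}|$. A tensor $\mathcal{A}$ of dimension $n\ge2$ is doubly strictly diagonally dominant (DSDD) if: when $m=2$, $|a_{i\cdots i}||a_{j\cdots j}|>r_i(\mathcal{A})r_j(\mathcal{A})$ for all $i,j\in N$, $i\neq j$; when $m>2$, $|a_{i\cdots i}|\ge r_i(\mathcal{A})$ for all $i\in N$ and $|a_{i\cdots i}||a_{j\cdots j}|>r_i(\mathcal{A})r_j(\mathcal{A})$ for all $i,j\in N$, $i\neq j$. For nonempty $J\subseteq N$, $\varepsilon^{J}$ denotes the partially all one tensor of order $m$ and dimension $n$: its $(i_1,\ldots,i_m)$ entry is $1$ if $i_1,\ldots,i_m\in J$, and $0$ otherwise. For $x\in\mathbb{R}^n$, $\mathcal{A}x^m=\sum_{i_1,\ldots,i_m\in N}a_{i_1\cdots i_m}x_{i_1}\cdots x_{i_m}$ and $(\mathcal{A}x^{m-1})_i=\sum_{i_2,\ldots,i_m\in N}a_{ii_2\cdots i_m}x_{i_2}\cdots x_{i_m}$. $\mathcal{A}$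 is positive definite if $\mathcal{A}x^m>0$ for every nonzero $x\in\mathbb{R}^n$. $\mathcal{A}$ is a $P$-tensor if $\max_{i\in N}x_i(\mathcal{A}x^{m-1})_i>0$ for every nonzero $x\in\mathbb{R}^n$. *)

(* Defs.v *)
From mathcomp Require Export all_boot all_order all_fingroup all_algebra.
From mathcomp Require Export constructive_ereal reals.

Set Implicit Arguments.
Unset Strict Implicit.
Unset Printing Implicit Defensive.

Export Order.TTheory GRing.Theory Num.Theory.
Global Open Scope ring_scope.

(* Values are taken in R^o only so that tensors inherit the R-module structure
   (entrywise +, \sum and *:). *)
Definition tensor (R : realType) (m n : nat) : Type :=
  {ffun m.-tuple 'I_n -> R^o}.

(* The index set N = {1, ..., n} is 'I_n.  Notions that single out the first
   index i of a_{i i_2 ... i_m} are stated for order m = p.+1, with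
   t = (i_2, ..., i_m) ranging over p.-tuple 'I_n. *)
Definition row_entry (R : realType) (p n : nat) (A : tensor R p.+1 n)
  (i : 'I_n) (t : p.-tuple 'I_n) : R := A [tuple of i :: t].

Definition diag_entry (R : realType) (m n : nat) (A : tensor R m n)
  (i : 'I_n) : R := A [tuple of nseq m i].

(* delta_{i_1 ... i_m} = 0 *)
Definition offdiag (n : nat) (t : seq 'I_n) : bool := ~~ constant t.

Definition symmetric_tensor (R : realType) (m n : nat) (A : tensor R m n) :
  Prop :=
  forall (s : 'S_m) (t : m.-tuple 'I_n),
    A [tuple tnth t (s k) | k < m] = A t.

Definition beta (R : realType) (p n : nat) (A : tensor R p.+1 n)
  (i : 'I_n) : R :=
  \big[Num.max/0]_(t : p.-tuple 'I_n | offdiag (i :: t)) row_entry A i t.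

Definition Delta (R : realType) (p n : nat) (A : tensor R p.+1 n)
  (i : 'I_n) : R :=
  \sum_(t : p.-tuple 'I_n | offdiag (i :: t)) (beta A i - row_entry A i t).

Definition double_B_tensor (R : realType) (p n : nat) (B : tensor R p.+1 n) :
  Prop :=
  [/\ forall i, diag_entry B i > beta B i,
      forall i, diag_entry B i - beta B i >= Delta B i
    & forall i j, i != j ->
        (diag_entry B i - beta B i) * (diag_entry B j - beta B j)
          > Delta B i * Delta B j].

Definition Z_tensor (R : realType) (m n : nat) (A : tensor R m n) : Prop :=
  forall t : m.-tuple 'I_n, offdiag t -> (A t : R) <= 0.

Definition offdiag_row_sum (R : realType) (p n : nat) (A : tensor R p.+1 n)
  (i : 'I_n) : R :=
  \sum_(t : p.-tuple 'I_n | offdiag (i :: t)) `|row_entry A i t|.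

Definition DSDD (R : realType) (p n : nat) (A : tensor R p.+1 n) : Prop :=
  let r := offdiag_row_sum A in
  let pairwise_dominant :=
    forall i j, i != j ->
      `|diag_entry A i| * `|diag_entry A j| > r i * r j in
  (p.+1 = 2%N -> pairwise_dominant) /\
  ((2 < p.+1)%N ->
     (forall i, `|diag_entry A i| >= r i) /\ pairwise_dominant).

Definition DSDD_symmetric_Z (R : realType) (p n : nat)
  (A : tensor R p.+1 n) : Prop :=
  [/\ DSDD A, symmetric_tensor A & Z_tensor A].

Definition all_one_on (R : realType) (m n : nat) (J : {set 'I_n}) :
  tensor R m n :=
  [ffun t : m.-tuple 'I_n => (all (mem J) t)%:R].

Definition tensor_form (R : realType) (m n : nat) (A : tensor R m n)
  (x : 'cV[R]_n) : R :=
  \sum_(t : m.-tuple 'I_n) A t * \prod_(k < m) x (tnth t k) 0.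

Definition tensor_apply (R : realType) (p n : nat) (A : tensor R p.+1 n)
  (x : 'cV[R]_n) (i : 'I_n) : R :=
  \sum_(t : p.-tuple 'I_n) row_entry A i t * \prod_(k < p) x (tnth t k) 0.

Definition positive_definite (R : realType) (m n : nat) (A : tensor R m n) :
  Prop :=
  forall x : 'cV[R]_n, x != 0 -> tensor_form A x > 0.

(* The maximum is taken in the extended reals, where -oo is its neutral
   element. *)
Definition P_tensor (R : realType) (p n : nat) (A : tensor R p.+1 n) : Prop :=
  forall x : 'cV[R]_n, x != 0 ->
    (0 < \big[Order.max/-oo]_(i < n) (x i 0 * tensor_apply A x i)%:E)%E.

(* Main.v *)
Require Import Defs.

(* Let J be the set of rows containing a positive off-diagonal entry, and h the
   least beta_i over J.  By symmetry a positive off-diagonal entry has all its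
   indices in J, so subtracting h times the all-one tensor on J lowers both
   beta_i and b_{i...i} by h for i in J, changes neither elsewhere, and does
   not increase Delta_i: the result is again a symmetric double B-tensor, with
   a strictly smaller J.  Iterating until J is empty leaves a Z-tensor, for
   which Delta_i = r_i, hence a DSDD one.
   For even order, AM-GM together with symmetry bounds the
   off-diagonal part of M x^m by sum_i r_i x_i^m; this settles positivity of
   M x^m unless x is supported on the rows with m_{i...i} = r_i, and pairwise
   dominance allows only one such row, where M x^m = m_{i...i} x_i^m.  The
   all-one tensors contribute even powers of partial sums of x. *)

Set Implicit Arguments.
Unset Strict Implicit.
Unset Printing Implicit Defensive.

(** * Permuting and splitting index tuples *)

Lemma perm_tuple_eq (T : eqType) (m : nat) (s : 'S_m) (t : m.-tuple T) :
  perm_eq [tuple tnth t (s k) | k < m] t.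
Proof. by apply/tuple_permP; exists s. Qed.

Lemma perm_constant (T : eqType) (s t : seq T) :
  perm_eq s t -> constant s = constant t.
Proof.
suff sub (u v : seq T) : perm_eq u v -> constant u -> constant v.
  by move=> st; apply/idP/idP; apply: sub; rewrite // perm_sym.
case: u => [|x u] /= uv; first by move/perm_size: uv; case: v.
move=> cu; apply: (@all_pred1_constant _ x); rewrite -(perm_all _ uv) /=.
by rewrite eqxx.
Qed.

Lemma sum_tuple_cons (V : nmodType) (T : finType) (p : nat)
    (P : pred (p.+1.-tuple T)) (F : p.+1.-tuple T -> V) :
  \sum_(t | P t) F t =
  \sum_i \sum_(t : p.-tuple T | P [tuple of i :: t]) F [tuple of i :: t].
Proof.
rewrite pair_big_dep /=.
rewrite (reindex (fun q : T * p.-tuple T => [tuple of q.1 :: q.2])) //=.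
exists (fun t => (thead t, [tuple of behead t])) => [[i t] _|t _].
  by congr pair; apply: val_inj.
by apply/esym/tuple_eta.
Qed.

Section Tensors.
Variables (R : realType) (n : nat).
Implicit Types (x : 'cV[R]_n).

(** * Row-wise expansion of forms, and the forms of all-one tensors *)

Lemma tensor_formE (p : nat) (A : tensor R p.+1 n) x :
  tensor_form A x = \sum_i x i 0 * tensor_apply A x i.
Proof.
rewrite /tensor_form sum_tuple_cons; apply: eq_bigr => i _.
rewrite /tensor_apply big_distrr; apply: eq_bigr => t _ /=.
rewrite big_ord_recl tnth0 mulrCA; congr (_ * (_ * _)).
by apply: eq_bigr => k _; rewrite tnthS.
Qed.

Lemma sum_diag (p : nat) (F : p.+1.-tuple 'I_n -> R) :
  \sum_(t : p.+1.-tuple 'I_n | ~~ offdiag t) F t = \sum_i F [tuple of nseq p.+1 i].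
Proof.
rewrite sum_tuple_cons; apply: eq_bigr => i _.
rewrite (big_pred1 [tuple of nseq p i]) => [|t /=].
  by congr F; apply: val_inj.
rewrite /offdiag negbK /= -val_eqE /=.
have := all_pred1P i t; rewrite size_tuple => tP.
exact/tP/eqP.
Qed.

Lemma all_one_form (m : nat) (J : {set 'I_n}) x :
  tensor_form (all_one_on R m J) x = (\sum_(i in J) x i 0) ^+ m.
Proof.
rewrite /tensor_form; elim: m => [|m IH].
  (* At order 0 the only index tuple is empty and lies vacuously in [J], so both sides equal 1. *)
  rewrite (big_pred1 [tuple]) => [|t]; first by rewrite ffunE big_ord0 mulr1.
  by apply/esym/eqP; rewrite [LHS]tuple0.
rewrite sum_tuple_cons exprS -IH big_distrl /= [RHS]big_mkcond.
apply: eq_bigr => i _; rewrite big_distrr /= -[LHS]/(\sum_t _ : R).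
case: ifP => iJ; last first.
  by rewrite big1 // => t _; rewrite ffunE /= iJ mul0r.
apply: eq_bigr => t _; rewrite !ffunE /= iJ big_ord_recl tnth0 mulrCA.
by congr (_ * (_ * _)); apply: eq_bigr => k _; rewrite tnthS.
Qed.

Lemma all_one_symmetric (m : nat) (J : {set 'I_n}) :
  symmetric_tensor (all_one_on R m J).
Proof. by move=> s t; rewrite !ffunE (perm_all _ (perm_tuple_eq s t)). Qed.

(** * AM-GM and positive definiteness under diagonal dominance *)

Lemma prod_le_mean_pow (m : nat) (y : 'I_m -> R) :
  (0 < m)%N -> (forall k, 0 <= y k) ->
  \prod_k y k <= m%:R^-1 * \sum_k y k ^+ m.
Proof.
move=> m0 y0; have S0 : 0 <= m%:R^-1 * \sum_k y k ^+ m.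
  by rewrite mulr_ge0 ?invr_ge0 ?ler0n // sumr_ge0 // => k _; rewrite exprn_ge0.
(* Raising both sides to the power [m] allows AM-GM to be applied to the numbers [y k ^+ m], without
   taking roots. *)
rewrite -(ler_pXn2r m0) ?nnegrE ?prodr_ge0 //.
have := @leif_AGM R 'I_m predT (fun k => y k ^+ m).
rewrite /= cardT size_enum_ord prodrXl mulrC => H.
by apply: (H _).1 => k _; rewrite exprn_ge0.
Qed.

(* By symmetry every position k of the index tuple contributes as much as the
   first one. *)
Lemma symmetric_offdiag_sum (p : nat) (A : tensor R p.+1 n)
    (w : 'I_n -> R) (k : 'I_p.+1) : symmetric_tensor A ->
  \sum_(t : p.+1.-tuple 'I_n | offdiag t) `|A t : R| * w (tnth t k) =
  \sum_i offdiag_row_sum A i * w i.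
Proof.
move=> sA; pose f (t : p.+1.-tuple 'I_n) :=
  [tuple tnth t (tperm ord0 k j) | j < p.+1].
have fK : involutive f.
  by move=> t; apply: eq_from_tnth => j; rewrite !tnth_mktuple tpermK.
rewrite (reindex_inj (inv_inj fK)) /=.
rewrite (eq_bigl (fun t : p.+1.-tuple 'I_n => offdiag t)) => [|t]; last first.
  by rewrite /offdiag (perm_constant (perm_tuple_eq _ t)).
rewrite sum_tuple_cons; apply: eq_bigr => i _; rewrite big_distrl /=.
by apply: eq_bigr => t _; rewrite sA tnth_mktuple tpermR tnth0.
Qed.

(** AM-GM replaces each monomial by the mean of its [p.+1] pure powers; all positions contribute
    equally, so the factor [p.+1] cancels the mean's denominator. *)
Lemma offdiag_form_bound (p : nat) (A : tensor R p.+1 n) x :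
  symmetric_tensor A ->
  `|\sum_(t : p.+1.-tuple 'I_n | offdiag t) A t * \prod_k x (tnth t k) 0 : R|
    <= \sum_i offdiag_row_sum A i * `|x i 0| ^+ p.+1.
Proof.
move=> sA; apply: le_trans (ler_norm_sum _ _ _) _.
have -> : \sum_i offdiag_row_sum A i * `|x i 0| ^+ p.+1 =
  \sum_(t : p.+1.-tuple 'I_n | offdiag t)
     `|A t : R| * (p.+1%:R^-1 * \sum_k `|x (tnth t k) 0| ^+ p.+1).
  under [RHS]eq_bigr => t _ do rewrite mulrCA mulr_sumr.
  rewrite -mulr_sumr exchange_big /=.
  under [X in _ * X]eq_bigr => k _ do
    rewrite (symmetric_offdiag_sum (fun i => `|x i 0| ^+ p.+1)) //.
  by rewrite sumr_const card_ord -[X in _ * X]mulr_natl mulKf ?pnatr_eq0.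
apply: ler_sum => t _; rewrite normrM normr_prod ler_wpM2l //.
exact: prod_le_mean_pow.
Qed.

Lemma form_diag_offdiag (p : nat) (A : tensor R p.+1 n) x :
  tensor_form A x = \sum_i diag_entry A i * x i 0 ^+ p.+1 +
    \sum_(t : p.+1.-tuple 'I_n | offdiag t) A t * \prod_k x (tnth t k) 0.
Proof.
rewrite /tensor_form (bigID (fun t : p.+1.-tuple 'I_n => ~~ offdiag t)) /=.
congr (_ + _); last by apply: eq_bigl => t; rewrite negbK.
rewrite sum_diag; apply: eq_bigr => i _; congr (_ * _).
under eq_bigr => k _ do rewrite tnth_nseq.
by rewrite prodr_const card_ord.
Qed.

Lemma dominant_positive_definite (p : nat) (A : tensor R p.+1 n) :
  ~~ odd p.+1 -> symmetric_tensor A ->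
  (forall i, 0 < diag_entry A i) ->
  (forall i, offdiag_row_sum A i <= diag_entry A i) ->
  (forall i j, i != j ->
     offdiag_row_sum A i * offdiag_row_sum A j
       < diag_entry A i * diag_entry A j) ->
  positive_definite A.
Proof.
move=> ev sA d0 dr dd x x0; rewrite form_diag_offdiag.
have nX i : `|x i 0| ^+ p.+1 = x i 0 ^+ p.+1.
  by rewrite -normrX ger0_norm // exprn_even_ge0.
have [j /andP[xj rj]|H] := pickP (fun j =>
  (x j 0 != 0) && (offdiag_row_sum A j < diag_entry A j)).
  have := offdiag_form_bound x sA; rewrite ler_norml => /andP[le0 _].
  (* The off-diagonal part is replaced by its lower bound, leaving a sum of nonnegative terms in
     which the term of [j] is positive. *)
  apply: (lt_le_trans (y := \sum_i
    (diag_entry A i - offdiag_row_sum A i) * x i 0 ^+ p.+1)).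
    rewrite (bigD1 j) //= ltr_pwDl //.
      by rewrite mulr_gt0 ?subr_gt0 // exprn_even_gt0 // xj orbT.
    by apply: sumr_ge0 => i _; rewrite mulr_ge0 ?subr_ge0 ?exprn_even_ge0.
  under eq_bigr => i _ do rewrite mulrBl.
  rewrite sumrB lerD2l; apply: le_trans le0.
  by under eq_bigr => i _ do rewrite -nX.
have [i xi] : exists i, x i 0 != 0.
  apply/existsP; apply: contraNT x0; rewrite negb_exists => /forallP x0.
  by apply/eqP/colP => i; rewrite mxE; apply/eqP; rewrite -[_ == _]negbK.
(* Every row met by the support of [x] now has equality in [dr]; two such rows would contradict the
   strict inequality [dd]. *)
have eqr j : x j 0 != 0 -> offdiag_row_sum A j = diag_entry A j.
  move=> xj; apply/le_anti; rewrite dr leNgt.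
  by have := H j; rewrite xj /= => ->.
have xj0 j : j != i -> x j 0 = 0.
  move=> ji; apply/eqP; apply: contraFT (ltxx (diag_entry A j * diag_entry A i)).
  by move=> xj; have := dd _ _ ji; rewrite !eqr.
rewrite (bigD1 i) //= big1 => [|j /xj0 ->]; last by rewrite expr0n mulr0.
rewrite addr0 big1 ?addr0 => [|t ot].
  by rewrite mulr_gt0 // exprn_even_gt0 // xi orbT.
(* An off-diagonal tuple has an index other than [i], where [x] vanishes, so its monomial is
   zero. *)
have /allPn[j /tnthP[k jk] ji] : ~~ all (pred1 i) t.
  by apply: contra ot => /all_pred1_constant.
by rewrite (bigD1 k) //= -jk xj0 // mul0r mulr0.
Qed.

(** The form is the sum over [i] of [x i 0 * tensor_apply A x i], so a positive value forces a
    positive summand. *)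
Lemma positive_definite_P_tensor (p : nat) (A : tensor R p.+1 n) :
  positive_definite A -> P_tensor A.
Proof.
move=> pdA x /pdA; rewrite tensor_formE => s0.
have [i xi|H] := pickP (fun i => 0 < x i 0 * tensor_apply A x i).
  by apply: lt_le_trans (le_bigmax _ _ i); rewrite lte_fin.
move: s0; rewrite ltNge sumr_le0 // => i _.
by rewrite leNgt H.
Qed.


(** * Subtracting a multiple of the all-one tensor on the support *)

Definition beta_support (p : nat) (A : tensor R p.+1 n) : {set 'I_n} :=
  [set i | 0 < beta A i].

Lemma beta_ge0 (p : nat) (A : tensor R p.+1 n) i : 0 <= beta A i.
Proof. exact: bigmax_ge_id. Qed.

Lemma le_beta (p : nat) (A : tensor R p.+1 n) i (t : p.-tuple 'I_n) :
  offdiag (i :: t) -> row_entry A i t <= beta A i.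
Proof.
by move=> ot; apply: (le_bigmax_cond 0 (row_entry A i) ot).
Qed.

Lemma Delta_ge0 (p : nat) (A : tensor R p.+1 n) i : 0 <= Delta A i.
Proof. by apply: sumr_ge0 => t ot; rewrite subr_ge0 le_beta. Qed.

(** A transposition brings any chosen index to the front without changing the entry, which then
    bounds [beta] of that index from below. *)
Lemma positive_entry_support (p : nat) (A : tensor R p.+1 n)
    (t : p.+1.-tuple 'I_n) :
  symmetric_tensor A -> offdiag t -> 0 < (A t : R) ->
  all (mem (beta_support A)) t.
Proof.
move=> sA ot At0; apply/allP => j /tnthP[k ->].
pose u := [tuple tnth t (tperm ord0 k l) | l < p.+1].
have uk : tnth u ord0 = tnth t k by rewrite tnth_mktuple tpermL.
have ou : offdiag u by rewrite /offdiag (perm_constant (perm_tuple_eq _ t)).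
have Au : 0 < (A u : R) by rewrite sA.
move: uk ou Au; case/tupleP: u => i u; rewrite tnth0 => <- ou Au.
by rewrite !inE; apply: lt_le_trans Au (le_beta A ou).
Qed.

Lemma nonsupport_entry_le0 (p : nat) (A : tensor R p.+1 n) i (t : p.-tuple 'I_n) :
  symmetric_tensor A -> offdiag (i :: t) ->
  ~~ all (mem (beta_support A)) (i :: t) -> row_entry A i t <= 0.
Proof.
move=> sA ot; apply: contraR; rewrite -ltNge => At.
exact: (positive_entry_support (t := [tuple of i :: t])).
Qed.

Section Peel.
Variables (p : nat) (A : tensor R p.+1 n) (h : R).
Hypotheses (sA : symmetric_tensor A) (h0 : 0 <= h).
Hypothesis h_le : forall i, i \in beta_support A -> h <= beta A i.
Let J := beta_support A.

Definition peel : tensor R p.+1 n := A - h *: all_one_on R p.+1 J.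

Lemma peelE t : (peel t : R) = A t - h * (all (mem J) t)%:R.
Proof. by rewrite !ffunE. Qed.

Lemma row_entry_peel i t :
  row_entry peel i t = row_entry A i t - h * (all (mem J) (i :: t))%:R.
Proof. exact: peelE. Qed.

Lemma peel_symmetric : symmetric_tensor peel.
Proof.
by move=> s t; rewrite !peelE (perm_all _ (perm_tuple_eq s t)) sA.
Qed.

Lemma diag_entry_peel i :
  diag_entry peel i = diag_entry A i - h * (i \in J)%:R.
Proof. by rewrite /diag_entry peelE all_nseq. Qed.

(** In a row of [J], off-diagonal entries with an index outside [J] are nonpositive by symmetry.
    They and the default 0 of the maximum thus stay below [beta A i - h], nonnegative by [h_le]; the
    other entries all drop by [h]. *)
Lemma beta_peel i : beta peel i = beta A i - h * (i \in J)%:R.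
Proof.
case: (boolP (i \in J)) => iJ; last first.
  rewrite mulr0 subr0; apply: eq_bigr => t _.
  by rewrite row_entry_peel /= (negPf iJ) mulr0 subr0.
have hb : 0 <= beta A i - h by rewrite subr_ge0 h_le.
rewrite mulr1; apply/le_anti/andP; split.
  apply: bigmax_le => // t ot; rewrite row_entry_peel.
  case: (boolP (all _ _)) => [_|nt]; first by rewrite mulr1 lerD2r le_beta.
  by rewrite mulr0 subr0 (le_trans _ hb) // nonsupport_entry_le0.
rewrite lerBlDr; apply: bigmax_le => [|t ot].
  by rewrite addr_ge0 // beta_ge0.
have [tJ|nt] := boolP (all (mem J) (i :: t)).
  have := le_beta peel ot.
  by rewrite row_entry_peel tJ mulr1 lerBlDr.
by rewrite (le_trans (nonsupport_entry_le0 sA ot nt)) // addr_ge0 // beta_ge0.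
Qed.

(** A term with all indices in [J] is unchanged. If the row is in [J] but another index is not, only
    [beta] drops, lowering the term by [h]. Rows outside [J] are untouched. *)
Lemma Delta_peel i : Delta peel i <= Delta A i.
Proof.
apply: ler_sum => t _; rewrite beta_peel row_entry_peel /=.
case: (i \in J) => /=; last by rewrite mulr0 !subr0.
rewrite mulr1; case: (all _ _); first by rewrite mulr1 opprB addrA subrK.
by rewrite mulr0 subr0 lerD2r gerBl.
Qed.

Lemma peel_double_B : double_B_tensor A -> double_B_tensor peel.
Proof.
have e i : diag_entry peel i - beta peel i = diag_entry A i - beta A i.
  by rewrite diag_entry_peel beta_peel opprB addrA subrK.
case=> b1 b2 b3; split => [i|i|i j ij].
- by rewrite -subr_gt0 e subr_gt0.
- by rewrite e (le_trans (Delta_peel i)).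
(* Nonnegativity of [Delta] lets the two bounds be multiplied. *)
- by rewrite !e (le_lt_trans _ (b3 i j ij)) // ler_pM ?Delta_ge0 ?Delta_peel.
Qed.

(** Strict inclusion makes the iteration terminate: a row with [beta A i = h] ends with [beta]
    zero. *)
Lemma beta_support_peel i : i \in J -> beta A i = h ->
  beta_support peel \proper beta_support A.
Proof.
move=> iJ bi; apply/properP; split.
  apply/subsetP => j; rewrite !inE beta_peel => /lt_le_trans; apply.
  by rewrite gerBl mulr_ge0.
by exists i => //; rewrite inE beta_peel iJ bi mulr1 subrr ltxx.
Qed.

End Peel.

(** * Decomposition and its consequences *)

Lemma double_B_decomposition (p : nat) (B : tensor R p.+1 n) :
  symmetric_tensor B -> double_B_tensor B ->
  exists (M : tensor R p.+1 n) (r : seq (R * {set 'I_n})),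
    [/\ symmetric_tensor M, double_B_tensor M, Z_tensor M,
        {in r, forall q, 0 < q.1 /\ q.2 != set0}
      & B = M + \sum_(q <- r) q.1 *: all_one_on R p.+1 q.2].
Proof.
have [N] := ubnP #|beta_support B|; elim: N B => // N IH B ltN sB dB.
have [J0|[i0 i0J]] := set_0Vmem (beta_support B).
  exists B, [::]; rewrite big_nil addr0; split => // t ot.
  rewrite leNgt; apply/negP => /(positive_entry_support sB ot).
  by case/tupleP: t {ot} => i t; rewrite J0 => /andP[]; rewrite !inE.
(* The amount subtracted is the least [beta] on the support: small enough for [h_le], yet enough to
   remove the minimizing row. *)
case: (Order.TotalTheory.arg_minP (beta B) i0J) => i iJ i_min.
have {}iJ : i \in beta_support B := iJ.
have bi0 : 0 < beta B i by move: iJ; rewrite inE.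
have [|||M [r [sM dM zM r0 eM]]] := IH (peel B (beta B i)).
- by rewrite -ltnS (leq_trans _ ltN) // ltnS proper_card //
    (beta_support_peel _ _ _ iJ) // ltW.
- exact: peel_symmetric.
- exact: (peel_double_B _ (ltW _)).
exists M, ((beta B i, beta_support B) :: r); split => //.
  move=> q; rewrite inE => /predU1P[->|/r0] //; split => //.
  by apply/set0Pn; exists i.
by rewrite big_cons addrCA -eM addrC subrK.
Qed.

(** Free of absolute values on the diagonal, so as to serve both the DSDD property and positive
    definiteness. *)
Lemma Z_double_B_dominant (p : nat) (M : tensor R p.+1 n) :
  double_B_tensor M -> Z_tensor M ->
  [/\ forall i, 0 < diag_entry M i,
      forall i, offdiag_row_sum M i <= diag_entry M i
    & forall i j, i != j -> offdiag_row_sum M i * offdiag_row_sum M j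
        < diag_entry M i * diag_entry M j].
Proof.
move=> dM zM; have b0 i : beta M i = 0.
  apply/le_anti; rewrite beta_ge0 andbT; apply: bigmax_le => // t ot.
  exact: (zM [tuple of i :: t]).
have rD i : Delta M i = offdiag_row_sum M i.
  apply: eq_bigr => t ot; rewrite b0 sub0r ler0_norm //.
  exact: (zM [tuple of i :: t]).
case: dM => b1 b2 b3; split => [i|i|i j ij].
- by rewrite -(b0 i).
- by have := b2 i; rewrite b0 subr0 rD.
- by have := b3 i j ij; rewrite !b0 !subr0 !rD.
Qed.

Lemma Z_double_B_DSDD (p : nat) (M : tensor R p.+1 n) :
  double_B_tensor M -> Z_tensor M -> DSDD M.
Proof.
move=> dM zM; have [d0 dr dd] := Z_double_B_dominant dM zM.
have pw i j : i != j -> offdiag_row_sum M i * offdiag_row_sum M j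
    < `|diag_entry M i| * `|diag_entry M j|.
  by move=> ij; rewrite !gtr0_norm ?dd.
by split=> // _; split=> // i; rewrite gtr0_norm.
Qed.

Lemma tensor_formD (m : nat) (A B : tensor R m n) x :
  tensor_form (A + B) x = tensor_form A x + tensor_form B x.
Proof.
by rewrite -big_split; apply: eq_bigr => t _; rewrite ffunE mulrDl.
Qed.

Lemma tensor_formZ (m : nat) (c : R) (A : tensor R m n) x :
  tensor_form (c *: A) x = c * tensor_form A x.
Proof.
by rewrite mulr_sumr; apply: eq_bigr => t _; rewrite ffunE mulrA.
Qed.

Lemma double_B_positive_definite (p : nat) (B : tensor R p.+1 n) :
  ~~ odd p.+1 -> symmetric_tensor B -> double_B_tensor B ->
  positive_definite B.
Proof.
move=> ev sB dB; have [M [r [sM dM zM r0 ->]]] := double_B_decomposition sB dB.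
have [d0 dr dd] := Z_double_B_dominant dM zM.
move=> x x0; have := dominant_positive_definite ev sM d0 dr dd x0.
rewrite tensor_formD => /ltr_pwDl; apply.
(* It remains that the sum of all-one terms has a nonnegative form, by induction on the list of
   terms. *)
elim: r r0 {B sB dB} => [|q r IH] r0.
  by rewrite big_nil /tensor_form big1 // => t _; rewrite ffunE mul0r.
rewrite big_cons tensor_formD tensor_formZ all_one_form addr_ge0 //.
  by rewrite mulr_ge0 ?exprn_even_ge0 // ltW // (r0 q (mem_head _ _)).1.
by apply: IH => u ur; apply: r0; rewrite inE ur orbT.
Qed.

End Tensors.

Theorem theorem6 (R : realType) (p n : nat) (hm : (2 <= p.+1)%N)
    (hn : (2 <= n)%N) (B : tensor R p.+1 n)
    (hsym : symmetric_tensor B) (hB : double_B_tensor B) :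
  (DSDD_symmetric_Z B \/
   exists (M : tensor R p.+1 n) (s : nat) (h : 'I_s -> R)
          (J : 'I_s -> {set 'I_n}),
     [/\ DSDD_symmetric_Z M,
         (0 < s)%N,
         forall k, 0 < h k,
         forall k, J k != set0
       & B = M + \sum_(k < s) h k *: all_one_on R p.+1 (J k)]) /\
  (~~ odd p.+1 -> positive_definite B /\ P_tensor B).
Proof.
split=> [|ev]; last first.
  have pdB := double_B_positive_definite ev hsym hB.
  by split=> //; apply: positive_definite_P_tensor.
have [M [r [sM dM zM r0 eB]]] := double_B_decomposition hsym hB.
have dsddM : DSDD_symmetric_Z M by split=> //; apply: Z_double_B_DSDD.
(* An empty list means [B = M], the first alternative; otherwise the list length is the required
   positive [s]. *)
have [r_nil|r_cons] := posnP (size r).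
  by left; rewrite eB (size0nil r_nil) big_nil addr0.
right; exists M, (size r), (fun k => (tnth (in_tuple r) k).1),
  (fun k => (tnth (in_tuple r) k).2).
split=> // [k|k|]; first exact: (r0 _ (mem_tnth k (in_tuple r))).1.
  exact: (r0 _ (mem_tnth k (in_tuple r))).2.
by rewrite eB big_tnth.
Qed.
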